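(* Let $A\in\mathbb{R}^{n\times d}$ have rows $a_1,\ldots,a_n\in\mathbb{R}^d$, let $b\in\mathbb{R}^n$, and let $p\in\mathbb{N}$, $p\ge1$. Suppose $A$ has full rank, $n\le d$, and $\kappa(A)^4<n/(n-1)$, where $\kappa(A)$ is the 2-norm condition number of $A$. Let $f(x)=\|Ax-b\|_{2p}^{2p}=\sum_{i=1}^n(a_i^Tx-b_i)^{2p}$, and let $L$ be the local first-order smoothness oracle (LFSO) for $f$ given by $$L(x,R)=2p(2p-1)\|A\|_2^2\cdot2^{2p-3}\left[\|Ax-b\|_\infty^{2p-2}+\left(\max_{i=1,\ldots,n}\|a_i\|_2^{2p-2}\right)R^{2p-2}\right].$$ Let $\eta\in(0,1]$ and let $(x_k)_{k\ge0}$ be generated from any $x_0\in\mathbb{R}^d$ by Gradient Descent with LFSO (in the form given in the context), with this $L$, stepsize factor $\eta$, and $R_k=\|Ax_k-b\|_\infty$ for all $k$. Then the residuals $r_k:=Ax_k-b$ satisfy $\|r_k\|\to0$ Q-linearly.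
   Context: $\|\cdot\|=\|\cdot\|_2$ is the Euclidean norm on vectors and $\|A\|_2$ the operator 2-norm. Conventions: $n/(n-1)=\infty$ when $n=1$, and zeroth powers equal $1$ (so $L(x,R)=2\|A\|_2^2$ when $p=1$). A local first-order smoothness oracle (LFSO) for $f$ is a function $L:\mathbb{R}^d\times(0,\infty)\to[0,\infty)$, non-decreasing in its second argument, with $|f(y)-f(x)-\nabla f(x)^T(y-x)|\le \frac{L(x,R)}{2}\|y-x\|^2$ for all $x\in\mathbb{R}^d$, $R>0$ and $y$ with $\|y-x\|\le R$. Gradient Descent with LFSO, in the form used here: for $k=0,1,2,\ldots$, with $R_k>0$ chosen, set $\widetilde{R}_k=\max\left\{R_k,\ \frac{\eta}{L(x_k,R_k)}C_k\right\}$, where $C_k=2p\,\|A\|_2\,\sqrt{n}\,\|Ax_k-b\|_\infty^{2p-1}$ is an upper bound for $\|\nabla f(x_k)\|$, and iterate $x_{k+1}=x_k-\frac{\eta}{L(x_k,\widetilde{R}_k)}\nabla f(x_k)$. Since the algorithm requires $R_k>0$, it is understood that $Ax_k\neq b$ for all $k$. $\|r_k\|\to0$ Q-linearly means there is $\rho\in(0,1)$ with $\|r_{k+1}\|\le\rho\|r_k\|$ for all $k\ge0$. *)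

(* Defs.v *)
From HB Require Import structures.
From mathcomp Require Import all_boot all_order all_algebra.
From mathcomp Require Import all_classical all_reals all_analysis.
From mathcomp Require Import ring lra.

Set Implicit Arguments.
Unset Strict Implicit.
Unset Printing Implicit Defensive.

Import Order.TTheory GRing.Theory Num.Theory.
Import numFieldNormedType.Exports.

Local Open Scope classical_set_scope.
Local Open Scope ring_scope.

(* Vectors are columns. The library norm `|v| on 'cV[R]_n is the max norm, i.e.
   the infinity norm; the Euclidean norm is [enorm]. *)
Definition enorm (R : realType) (n : nat) (v : 'cV[R]_n) : R :=
  Num.sqrt (\sum_(i < n) v i 0 ^+ 2).

Definition opnorm (R : realType) (m n : nat) (A : 'M[R]_(m, n)) : R :=
  sup [set enorm (A *m x) | x in [set x : 'cV[R]_n | enorm x <= 1]].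

(* The four Penrose equations; over the reals they have exactly one solution,
   the Moore-Penrose inverse. *)
Definition penrose (R : realType) (m n : nat) (A : 'M[R]_(m, n))
    (X : 'M[R]_(n, m)) : Prop :=
  [/\ A *m X *m A = A, X *m A *m X = X,
      (A *m X)^T = A *m X & (X *m A)^T = X *m A].

Definition mpinv (R : realType) (m n : nat) (A : 'M[R]_(m, n)) : 'M[R]_(n, m) :=
  get [set X | penrose A X].

Definition cond2 (R : realType) (m n : nat) (A : 'M[R]_(m, n)) : R :=
  opnorm A * opnorm (mpinv A).

Definition grad (R : realType) (d : nat) (f : 'cV[R]_d -> R) (x : 'cV[R]_d) :
    'cV[R]_d :=
  \col_(j < d) 'D_(delta_mx j 0) f x.

(* The second argument of an oracle ranges over (0, +oo); its values elsewhere
   are irrelevant. *)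
Definition is_lfso (R : realType) (d : nat) (f : 'cV[R]_d -> R)
    (L : 'cV[R]_d -> R -> R) : Prop :=
  [/\ forall x r, 0 < r -> 0 <= L x r,
      forall x r s, 0 < r -> r <= s -> L x r <= L x s &
      forall x r, 0 < r -> forall y, enorm (y - x) <= r ->
        `|f y - f x - ((grad f x)^T *m (y - x)) 0 0|
          <= L x r / 2 * enorm (y - x) ^+ 2].

Record lfso (R : realType) (d : nat) (f : 'cV[R]_d -> R) := Lfso {
  lfso_fun :> 'cV[R]_d -> R -> R;
  lfsoP : is_lfso f lfso_fun }.

(* [x] is a run of gradient descent with the oracle [L], stepsize factor [eta],
   radii [rad k] and upper bounds [C k] on the gradient norms. *)
Definition gd_lfso (R : realType) (d : nat) (f : 'cV[R]_d -> R) (L : lfso f)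
    (eta : R) (rad C : nat -> R) (x : nat -> 'cV[R]_d) : Prop :=
  forall k, 0 < rad k /\
    let rad' := Num.max (rad k) (eta / L (x k) (rad k) * C k) in
    x k.+1 = x k - (eta / L (x k) rad') *: grad f (x k).

Definition q_linear_to0 (R : realType) (u : nat -> R) : Prop :=
  exists rho : R, 0 < rho < 1 /\ forall k, u k.+1 <= rho * u k.

Definition pow_loss (R : realType) (n d : nat) (A : 'M[R]_(n, d))
    (b : 'cV[R]_n) (p : nat) (x : 'cV[R]_d) : R :=
  \sum_(i < n) ((A *m x) i 0 - b i 0) ^+ (2 * p).

Definition pow_oracle (R : realType) (n d : nat) (A : 'M[R]_(n, d))
    (b : 'cV[R]_n) (p : nat) (x : 'cV[R]_d) (r : R) : R :=
  (2 * p)%:R * ((2 * p)%:R - 1) * opnorm A ^+ 2 * 2 ^ ((2 * p)%:Z - 3)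
  * (`|A *m x - b| ^+ (2 * p - 2)
     + (\big[Num.max/0]_(i < n) enorm (row i A)^T ^+ (2 * p - 2))
       * r ^+ (2 * p - 2)).

Definition pow_grad_bound (R : realType) (n d : nat) (A : 'M[R]_(n, d))
    (b : 'cV[R]_n) (p : nat) (x : 'cV[R]_d) : R :=
  (2 * p)%:R * opnorm A * Num.sqrt n%:R * `|A *m x - b| ^+ (2 * p - 1).

Section Enorm.
Variable R : realType.

Lemma sqr_enorm n (v : 'cV[R]_n) : enorm v ^+ 2 = \sum_(i < n) v i 0 ^+ 2.
Proof. by rewrite sqr_sqrtr// sumr_ge0// => i _; exact: sqr_ge0. Qed.

Lemma enorm_ge0 n (v : 'cV[R]_n) : 0 <= enorm v.
Proof. exact: sqrtr_ge0. Qed.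

Lemma enorm_coord n (v : 'cV[R]_n) i : `|v i 0| <= enorm v.
Proof.
rewrite -ler_sqr ?nnegrE ?enorm_ge0// sqr_enorm real_normK ?num_real//.
by rewrite (bigD1 i)//= lerDl sumr_ge0// => j _; exact: sqr_ge0.
Qed.

Lemma enorm0 n : enorm (0 : 'cV[R]_n) = 0.
Proof.
by rewrite /enorm big1 ?sqrtr0// => i _; rewrite mxE expr0n.
Qed.

Lemma enorm_eq0 n (v : 'cV[R]_n) : enorm v = 0 -> v = 0.
Proof.
move=> v0; apply/colP => i; apply/eqP; rewrite mxE -normr_le0.
by rewrite -v0 enorm_coord.
Qed.

Lemma enormZ n a (v : 'cV[R]_n) : enorm (a *: v) = `|a| * enorm v.
Proof.
rewrite /enorm -sqrtr_sqr -sqrtrM ?sqr_ge0// mulr_sumr; congr Num.sqrt.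
by apply: eq_bigr => i _; rewrite mxE exprMn.
Qed.

Lemma cauchy_schwarz_sum n (a c : 'I_n -> R) :
  (\sum_i a i * c i) ^+ 2 <= (\sum_i a i ^+ 2) * (\sum_i c i ^+ 2).
Proof.
have : 0 <= \sum_i \sum_j (a i * c j - a j * c i) ^+ 2.
  by apply: sumr_ge0 => i _; apply: sumr_ge0 => j _; exact: sqr_ge0.
under eq_bigr do under eq_bigr do
  rewrite sqrrB !exprMn -mulr_natr (mulrC (a _) (c _)).
have -> : \sum_i \sum_j (a i ^+ 2 * c j ^+ 2 - c j * a i * (a j * c i) * 2%:R
     + a j ^+ 2 * c i ^+ 2) = 2 * ((\sum_i a i ^+ 2) * (\sum_i c i ^+ 2)
     - (\sum_i a i * c i) ^+ 2).
  have e1 : (\sum_i a i ^+ 2) * (\sum_i c i ^+ 2)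
      = \sum_i \sum_j a i ^+ 2 * c j ^+ 2 by rewrite big_distrlr.
  have e2 : (\sum_i a i ^+ 2) * (\sum_i c i ^+ 2)
      = \sum_i \sum_j a j ^+ 2 * c i ^+ 2 by rewrite e1 exchange_big.
  have e3 : (\sum_i a i * c i) ^+ 2 *+ 2
      = \sum_i \sum_j c j * a i * (a j * c i) * 2%:R.
    rewrite expr2 big_distrlr/= -mulr_natr mulr_suml; apply: eq_bigr => i _.
    by rewrite mulr_suml; apply: eq_bigr => j _; ring.
  rewrite mulrBr [2 * (_ ^+ 2)]mulr_natl e3 mulr_natl mulr2n.
  rewrite [X in X + _ - _]e1 [X in _ + X - _]e2.
  under eq_bigr do rewrite big_split sumrB /=.
  by rewrite big_split sumrB /= addrAC.
by rewrite pmulr_rge0// subr_ge0.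
Qed.

Lemma row_mul_le n d (A : 'M[R]_(n, d)) (v : 'cV[R]_d) i :
  `|(A *m v) i 0| <= enorm (row i A)^T * enorm v.
Proof.
rewrite -ler_sqr ?nnegrE ?mulr_ge0 ?enorm_ge0//.
rewrite exprMn !sqr_enorm real_normK ?num_real//.
have -> : (A *m v) i 0 = \sum_j (row i A)^T j 0 * v j 0.
  by rewrite mxE; apply: eq_bigr => j _; rewrite !mxE.
exact: cauchy_schwarz_sum.
Qed.

Lemma enorm_mul_le n d (A : 'M[R]_(n, d)) (v : 'cV[R]_d) :
  enorm (A *m v) <= opnorm A * enorm v.
Proof.
have ub : has_ubound [set enorm (A *m x) | x in [set x | enorm x <= 1]].
  exists (Num.sqrt (\sum_(i < n) enorm (row i A)^T ^+ 2)) => _ [x /= x1 <-].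
  rewrite ler_wsqrtr// ler_sum// => i _.
  rewrite -[leLHS]real_normK ?num_real// lerXn2r ?nnegrE ?enorm_ge0//.
  by rewrite (le_trans (row_mul_le _ _ _))// ler_piMr ?enorm_ge0.
have [/enorm_eq0 -> | v0] := eqVneq (enorm v) 0.
  by rewrite mulmx0 !enorm0 mulr0.
have vp : 0 < enorm v by rewrite lt_neqAle eq_sym v0 enorm_ge0.
rewrite -ler_pdivrMr//.
have -> : enorm (A *m v) / enorm v = enorm (A *m ((enorm v)^-1 *: v)).
  by rewrite -scalemxAr enormZ gtr0_norm ?invr_gt0// mulrC.
apply: ub_le_sup => //; exists ((enorm v)^-1 *: v) => //=.
by rewrite enormZ gtr0_norm ?invr_gt0// mulVf.
Qed.

End Enorm.

Section PowOracle.
Variable R : realType.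

Lemma pow_taylor (u s : R) m :
  `|(u + s) ^+ m - u ^+ m - m%:R * u ^+ m.-1 * s|
    <= m%:R * (m%:R - 1) / 2 * (`|u| + `|s|) ^+ (m - 2) * s ^+ 2.
Proof.
case: m => [|[|k]].
- by rewrite !expr0 subrr !mul0r subrr normr0.
- have -> : (u + s) ^+ 1 - u ^+ 1 - 1%:R * u ^+ 0 * s = 0.
    by rewrite !expr1 expr0; ring.
  by rewrite normr0 subrr mulr0 !mul0r.
rewrite subn2 /=; elim: k => [|k IH].
  rewrite !expr2 expr1 expr0 mulr1.
  have -> : (u + s) * (u + s) - u * u - 2%:R * u * s = s * s by ring.
  by rewrite -expr2 ger0_norm ?sqr_ge0//; nra.
set E := (u + s) ^+ k.+2 - _ - _ in IH.
have -> : (u + s) ^+ k.+3 - u ^+ k.+3 - k.+3%:R * u ^+ k.+2 * s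
    = (u + s) * E + k.+2%:R * u ^+ k.+1 * s ^+ 2.
  by rewrite /E !exprS -!natr1; ring.
set M : R := `|u| + `|s| in IH *.
have M0 : 0 <= M by rewrite addr_ge0.
apply: (le_trans (ler_normD _ _)).
have h1 : `|(u + s) * E|
    <= M * (k.+2%:R * (k.+2%:R - 1) / 2 * M ^+ k * s ^+ 2).
  by rewrite normrM ler_pM// ler_normD.
have h2 : `|k.+2%:R * u ^+ k.+1 * s ^+ 2| <= k.+2%:R * M ^+ k.+1 * s ^+ 2.
  rewrite normrM (ger0_norm (sqr_ge0 s)) normrM normr_nat.
  rewrite ler_wpM2r ?sqr_ge0//.
  by rewrite ler_wpM2l// normrX lerXn2r ?nnegrE// lerDl.
apply: le_trans (lerD h1 h2) _; rewrite le_eqVlt; apply/orP; left; apply/eqP.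
by rewrite (exprS M) -[k.+3%:R]natr1; field.
Qed.

Lemma pow_mean (a c : R) k : 0 <= a -> 0 <= c ->
  (a + c) ^+ k <= 2 ^ (k%:Z - 1) * (a ^+ k + c ^+ k).
Proof.
move=> a0 c0; have -> : 2 ^ (k%:Z - 1) = 2 ^+ k / 2 :> R.
  by rewrite expfzDr ?pnatr_eq0// -exprnP exprN1.
elim: k => [|k IH]; first by rewrite !expr0; lra.
have h : (a ^+ k + c ^+ k) * (a + c) <= 2 * (a ^+ k.+1 + c ^+ k.+1).
  have : 0 <= (a ^+ k - c ^+ k) * (a - c).
    have [ac|/ltW ca] := leP a c.
      by rewrite mulr_le0// subr_le0// lerXn2r.
    by rewrite mulr_ge0// subr_ge0// lerXn2r.
  rewrite !exprS; nra.
rewrite exprSr; apply: le_trans (ler_wpM2r (addr_ge0 a0 c0) IH) _.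
have k0 : 0 <= 2 ^+ k / 2 :> R by rewrite divr_ge0 ?exprn_ge0.
rewrite -[leLHS]mulrA; apply: le_trans (ler_wpM2l k0 h) _.
by rewrite [in leRHS]exprSr; lra.
Qed.

Lemma grad_pow_loss n d (A : 'M[R]_(n, d)) (b : 'cV[R]_n) p (x v : 'cV[R]_d) :
  ((grad (pow_loss A b p) x)^T *m v) 0 0 =
  \sum_(i < n) (2 * p)%:R * ((A *m x) i 0 - b i 0) ^+ (2 * p).-1
               * (A *m v) i 0.
Proof.
pose g i (z : 'cV[R]_d) := (A *m z) i 0 - b i 0.
have dg i (w : 'cV[R]_d) : is_derive x w (g i) ((A *m w) i 0).
  suff cv : h^-1 *: ((g i \o shift x) (h *: w) - g i x) @[h --> 0^'] -->
      (A *m w) i 0.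
    by apply: DeriveDef; [apply/cvg_ex; exists ((A *m w) i 0) | exact: cvg_lim].
  apply: cvg_near_cst; near=> h.
  have h0 : h != 0 by near: h; exact: nbhs_dnbhs_neq.
  rewrite /g /= mulmxDr -scalemxAr !mxE opprB addrA subrK addrK.
  by rewrite scalerA mulVf// scale1r.
have dF w : 'D_w (pow_loss A b p) x =
    \sum_(i < n) (2 * p)%:R * g i x ^+ (2 * p).-1 * (A *m w) i 0.
  have -> : pow_loss A b p = \sum_(i < n) (g i ^+ (2 * p)).
    apply/funext => z; rewrite fct_sumE; apply: eq_bigr => i _.
    by rewrite exprfctE.
  by rewrite derive_val.
rewrite mxE; under eq_bigr do rewrite !mxE dF mulr_suml.
rewrite exchange_big; apply: eq_bigr => i _ /=.
rewrite /g [(A *m v) i 0]mxE mulr_sumr; apply: eq_bigr => j _.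
rewrite -!mulrA; congr (_ * (_ * (_ * _))).
by rewrite -colE mxE.
Unshelve. all: by end_near.
Qed.

Lemma pow_oracle_lfso n d (A : 'M[R]_(n, d)) (b : 'cV[R]_n) p :
  is_lfso (pow_loss A b p) (pow_oracle A b p).
Proof.
pose amax := \big[Num.max/0]_(i < n) enorm (row i A)^T ^+ (2 * p - 2).
have amax0 : 0 <= amax by exact: bigmax_ge_id.
have c0 : 0 <= (2 * p)%:R * ((2 * p)%:R - 1) :> R.
  case: (p) => [|q]; first by rewrite mul0r.
  by rewrite mulr_ge0// subr_ge0 ler1n.
have c1 : 0 <= (2 * p)%:R * ((2 * p)%:R - 1) * opnorm A ^+ 2
    * 2 ^ ((2 * p)%:Z - 3) :> R.
  by apply: mulr_ge0; [exact: mulr_ge0 c0 (sqr_ge0 _) | exact: exprz_ge0].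
split.
- move=> x r r0; rewrite /pow_oracle mulr_ge0// addr_ge0 ?exprn_ge0//.
  by rewrite mulr_ge0// exprn_ge0// ltW.
- move=> x r s r0 rs; rewrite /pow_oracle ler_wpM2l// lerD2l ler_wpM2l//.
  by rewrite lerXn2r ?nnegrE ?(le_trans (ltW r0) rs)// ltW.
move=> x r r0 y yx; rewrite grad_pow_loss /pow_loss -!sumrB.
set v := y - x in yx *; set m := (2 * p)%N in c0 c1 *.
pose K : R := 2 ^ (m%:Z - 3)
  * (`|A *m x - b| ^+ (m - 2) + amax * r ^+ (m - 2)).
apply: le_trans (ler_norm_sum _ _ _) _.
have step i : `|((A *m y) i 0 - b i 0) ^+ m - ((A *m x) i 0 - b i 0) ^+ m
     - m%:R * ((A *m x) i 0 - b i 0) ^+ m.-1 * (A *m v) i 0|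
   <= m%:R * (m%:R - 1) / 2 * K * (A *m v) i 0 ^+ 2.
  have -> : (A *m y) i 0 - b i 0 = ((A *m x) i 0 - b i 0) + (A *m v) i 0.
    by rewrite /v mulmxBr !mxE; ring.
  apply: le_trans (pow_taylor _ _ _) _; rewrite ler_wpM2r ?sqr_ge0//.
  have [p0|p0] := posnP p; first by rewrite /m p0 !mul0r.
  rewrite ler_wpM2l ?divr_ge0//.
  have u_le : `|(A *m x) i 0 - b i 0| <= `|A *m x - b|.
    have -> : (A *m x) i 0 - b i 0 = (A *m x - b) i 0 by rewrite !mxE.
    rewrite [leRHS]/Num.norm /= mx_normrE.
    exact: (le_bigmax _ (fun ij => `|(A *m x - b) ij.1 ij.2|) (i, 0)).
  have s_le : `|(A *m v) i 0| <= enorm (row i A)^T * r.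
    by apply: le_trans (row_mul_le _ _ _) _; rewrite ler_wpM2l ?enorm_ge0.
  have e_ge0 : 0 <= enorm (row i A)^T * r by rewrite mulr_ge0 ?enorm_ge0// ltW.
  apply: (@le_trans _ _ ((`|A *m x - b| + enorm (row i A)^T * r) ^+ (m - 2))).
    by rewrite lerXn2r ?nnegrE ?addr_ge0// lerD.
  apply: le_trans (pow_mean _ _ _) _ => //.
  have -> : (m - 2)%:Z - 1 = m%:Z - 3.
    by rewrite /m -subzn ?leq_pmulr// -addrA -opprD.
  rewrite /K ler_wpM2l ?exprz_ge0// lerD2l exprMn ler_wpM2r ?exprn_ge0 ?(ltW r0)//.
  exact: (le_bigmax _ (fun i => enorm (row i A)^T ^+ (m - 2))).
apply: le_trans (ler_sum _ (fun i _ => step i)) _.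
rewrite -mulr_sumr -sqr_enorm.
have K0 : 0 <= m%:R * (m%:R - 1) / 2 * K.
  rewrite mulr_ge0 ?divr_ge0// mulr_ge0 ?exprz_ge0// addr_ge0 ?exprn_ge0//.
  by rewrite mulr_ge0// exprn_ge0// ltW.
have -> : pow_oracle A b p x r / 2 * enorm v ^+ 2
    = m%:R * (m%:R - 1) / 2 * K * (opnorm A * enorm v) ^+ 2.
  by rewrite /pow_oracle /K /amax -/m exprMn; lra.
rewrite ler_wpM2l// lerXn2r ?nnegrE ?enorm_ge0 ?enorm_mul_le//.
by rewrite (le_trans (enorm_ge0 _) (enorm_mul_le A v)).
Qed.

End PowOracle.

Definition pow_lfso (R : realType) (n d : nat) (A : 'M[R]_(n, d))
    (b : 'cV[R]_n) (p : nat) : lfso (pow_loss A b p) :=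
  Lfso (pow_oracle_lfso A b p).

(* Main.v *)
(** With r = A x - b, M = A A^T and u the vector of the r_i^(2p-1), a step is
    r |-> r - s M u. Dividing u by |r|_oo^(2p-2) makes the stepsize a constant
    t, because the oracle and the radius are homogeneous in |r|_oo. Three facts
    give the contraction.
    - The quadratic term t^2 |M u|^2 <= t^2 |A|^2 (u . M u) is absorbed into
      the linear one by replacing r with w = r - c u, where c = t |A|^2 / 2.
    - The coordinates of w and u have the same signs and are simultaneously
      maximal, so cos(w, u) >= 1 / sqrt n; and cos(u, M u) >= 1 / kappa(A).
    - Hence cos(w, M u) >= (1 / n + 1 / kappa(A)^2 - 1) / 2, which is positive
      since kappa(A)^2 <= kappa(A)^4 < n / (n - 1). *)

Require Import Defs.
From HB Require Import structures.
From mathcomp Require Import all_boot all_order all_algebra.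
From mathcomp Require Import all_classical all_reals all_analysis.
From mathcomp Require Import ring lra.

Set Implicit Arguments.
Unset Strict Implicit.
Unset Printing Implicit Defensive.

Import Order.TTheory GRing.Theory Num.Theory.
Import numFieldNormedType.Exports.

Local Open Scope classical_set_scope.
Local Open Scope ring_scope.

(** * Euclidean inner products and cosines of angles *)

Definition dot (R : realType) (n : nat) (u v : 'cV[R]_n) : R := (u^T *m v) 0 0.

Definition cosv (R : realType) (n : nat) (u v : 'cV[R]_n) : R :=
  dot u v / (enorm u * enorm v).

Section Dot.
Variable R : realType.

Lemma dotE n (u v : 'cV[R]_n) : dot u v = \sum_i u i 0 * v i 0.
Proof. by rewrite /dot mxE; apply: eq_bigr => i _; rewrite mxE. Qed.

Lemma dotC n (u v : 'cV[R]_n) : dot u v = dot v u.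
Proof. by rewrite !dotE; apply: eq_bigr => i _; rewrite mulrC. Qed.

Lemma dotDr n (u v w : 'cV[R]_n) : dot u (v + w) = dot u v + dot u w.
Proof. by rewrite /dot mulmxDr mxE. Qed.

Lemma dotZr n a (u v : 'cV[R]_n) : dot u (a *: v) = a * dot u v.
Proof. by rewrite /dot -scalemxAr mxE. Qed.

Lemma dotBr n (u v w : 'cV[R]_n) : dot u (v - w) = dot u v - dot u w.
Proof. by rewrite -scaleN1r dotDr dotZr mulN1r. Qed.

Lemma dotBl n (u v w : 'cV[R]_n) : dot (v - w) u = dot v u - dot w u.
Proof. by rewrite !(dotC _ u) dotBr. Qed.

Lemma dotZl n a (u v : 'cV[R]_n) : dot (a *: u) v = a * dot u v.
Proof. by rewrite !(dotC _ v) dotZr. Qed.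

Lemma dot_trmx n d (A : 'M[R]_(n, d)) u v : dot (A^T *m u) v = dot u (A *m v).
Proof. by rewrite /dot trmx_mul trmxK mulmxA. Qed.

Lemma dotvv n (u : 'cV[R]_n) : dot u u = enorm u ^+ 2.
Proof. by rewrite dotE sqr_enorm; apply: eq_bigr => i _; rewrite expr2. Qed.

Lemma sqr_dot_le n (u v : 'cV[R]_n) :
  dot u v ^+ 2 <= enorm u ^+ 2 * enorm v ^+ 2.
Proof. by rewrite dotE !sqr_enorm cauchy_schwarz_sum. Qed.

Lemma dot_le n (u v : 'cV[R]_n) : dot u v <= enorm u * enorm v.
Proof.
rewrite (le_trans (ler_norm _))// -ler_sqr ?nnegrE ?mulr_ge0 ?enorm_ge0//.
by rewrite real_normK ?num_real// exprMn sqr_dot_le.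
Qed.

Lemma enorm_gt0 n (v : 'cV[R]_n) : (0 < enorm v) = (v != 0).
Proof.
rewrite lt_neqAle enorm_ge0 andbT eq_sym; congr negb.
by apply/eqP/eqP => [/enorm_eq0|->]; rewrite ?enorm0.
Qed.

Lemma enorm_sqrB n (u v : 'cV[R]_n) :
  enorm (u - v) ^+ 2 = enorm u ^+ 2 - 2 * dot u v + enorm v ^+ 2.
Proof. by rewrite -!dotvv dotBl !dotBr (dotC v u); ring. Qed.

Lemma coord_le_norm n (v : 'cV[R]_n) i : `|v i 0| <= `|v|.
Proof.
rewrite [leRHS]/Num.norm /= mx_normrE.
exact: (le_bigmax _ (fun ij => `|v ij.1 ij.2|) (i, 0)).
Qed.

Lemma norm_attained n (v : 'cV[R]_n) : v != 0 -> exists i, `|v i 0| = `|v|.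
Proof.
rewrite -normr_eq0 => /mx_norm_neq0 [[i j] vE]; exists i.
by rewrite [RHS]/Num.norm /= vE /= (ord1 j).
Qed.

Lemma enorm_le_bound n (v : 'cV[R]_n) W :
  0 <= W -> (forall i, `|v i 0| <= W) -> enorm v ^+ 2 <= n%:R * W ^+ 2.
Proof.
move=> W0 vW; rewrite sqr_enorm mulr_natl -[in leRHS](card_ord n) -sumr_const.
apply: ler_sum => i _.
by rewrite -[leLHS]real_normK ?num_real// lerXn2r ?nnegrE.
Qed.

(** Cauchy-Schwarz for the components of [a] and [v] orthogonal to [u]. *)
Lemma gram_ineq n (a u v : 'cV[R]_n) :
    enorm a = 1 -> enorm u = 1 -> enorm v = 1 ->
  (dot a v - dot a u * dot u v) ^+ 2 <= (1 - dot a u ^+ 2) * (1 - dot u v ^+ 2).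
Proof.
move=> a1 u1 v1.
have := sqr_dot_le (a - dot a u *: u) (v - dot u v *: u).
rewrite !enorm_sqrB !dotBl !dotBr !enormZ !exprMn !real_normK ?num_real//.
rewrite !dotZl !dotZr dotvv a1 u1 v1 (dotC v u); congr (_ <= _); ring.
Qed.

Lemma enorm_normalize n (v : 'cV[R]_n) :
  v != 0 -> enorm ((enorm v)^-1 *: v) = 1.
Proof.
rewrite -enorm_gt0 => v0.
by rewrite enormZ gtr0_norm ?invr_gt0// mulVf// gt_eqF.
Qed.

Lemma cosv_normalize n (u v : 'cV[R]_n) :
  cosv u v = dot ((enorm u)^-1 *: u) ((enorm v)^-1 *: v).
Proof. by rewrite /cosv dotZl dotZr invfM; ring. Qed.

(* For angles s, t with cos s, cos t >= 0, the bound is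
   cos (s + t) = (cos^2 s + cos^2 t - 1) / (cos s cos t + sin s sin t). *)
Lemma cosv_trans n (a u v : 'cV[R]_n) :
    a != 0 -> u != 0 -> v != 0 -> 0 <= cosv a u -> 0 <= cosv u v ->
    1 <= cosv a u ^+ 2 + cosv u v ^+ 2 ->
  (cosv a u ^+ 2 + cosv u v ^+ 2 - 1) / 2 <= cosv a v.
Proof.
move=> /enorm_normalize a1 /enorm_normalize u1 /enorm_normalize v1.
rewrite !cosv_normalize; move: a1 u1 v1.
move: (_ *: a) (_ *: u) (_ *: v) => {}a {}u {}v a1 u1 v1.
have := gram_ineq a1 u1 v1.
have := sqr_dot_le a u; have := sqr_dot_le u v.
rewrite a1 u1 v1 !expr1n mulr1.
move: (dot a u) (dot u v) (dot a v) => x y z y1 x1 xyz x0 y0 xy1.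
set s := Num.sqrt ((1 - x ^+ 2) * (1 - y ^+ 2)).
have s0 : 0 <= s by exact: sqrtr_ge0.
have s2 : s ^+ 2 = (1 - x ^+ 2) * (1 - y ^+ 2).
  by rewrite sqr_sqrtr// mulr_ge0// subr_ge0.
have zs : x * y - s <= z.
  have : `|z - x * y| <= s.
    by rewrite -ler_sqr ?nnegrE// s2 real_normK ?num_real.
  by rewrite ler_norml => /andP[]; lra.
apply: le_trans zs.
have x1' : x <= 1 by nra.
have y1' : y <= 1 by nra.
have s1' : s <= 1 by nra.
have xy0 : 0 <= x * y by rewrite mulr_ge0.
have xy1' : x * y <= 1 by nra.
move: s2 xy0 xy1'; set P := x * y => s2 P0 P1.
have e : (P - s) * (P + s) = x ^+ 2 + y ^+ 2 - 1.
  by rewrite -subr_sqr s2 /P; ring.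
have Ps : 0 <= P - s.
  have : s ^+ 2 <= P ^+ 2 by rewrite -subr_ge0 subr_sqr e; lra.
  by rewrite ler_sqr ?nnegrE// subr_ge0.
(* Both [P] and [s] are at most 1, so [P + s <= 2], and [e] then bounds [P - s] from below by half
   of its right-hand side. *)
nra.
Qed.

(** Summing the coordinate bounds gives |w|^2 <= n W^2 and W |u|^2 <= U (w . u), while index [j]
    alone gives W U <= w . u. Chained together, |w|^2 |u|^2 <= n (w . u)^2. *)
Lemma sqr_cosv_ge n (w u : 'cV[R]_n) (W U : R) j :
    0 < W -> 0 < U -> w j 0 * u j 0 = W * U -> w != 0 -> u != 0 ->
    (forall i, [/\ `|w i 0| <= W, W * `|u i 0| <= U * `|w i 0|
                 & 0 <= w i 0 * u i 0]) ->
  0 <= cosv w u /\ n%:R^-1 <= cosv w u ^+ 2.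
Proof.
move=> W0 U0 wuj; rewrite -!enorm_gt0 => w0 u0 wu.
have wuE i : w i 0 * u i 0 = `|w i 0| * `|u i 0|.
  by rewrite -normrM ger0_norm//; case: (wu i).
have n0 : 0 < n%:R :> R by rewrite ltr0n (leq_ltn_trans _ (ltn_ord j)).
have WUle : W * U <= dot w u.
  rewrite dotE (bigD1 j)//= wuj lerDl sumr_ge0// => i _.
  by case: (wu i).
have wn : enorm w ^+ 2 <= n%:R * W ^+ 2.
  by apply: enorm_le_bound => [|i]; [exact: ltW | case: (wu i)].
have un : W * enorm u ^+ 2 <= U * dot w u.
  rewrite sqr_enorm dotE !mulr_sumr; apply: ler_sum => i _.
  case: (wu i) => _ wui _; rewrite wuE -real_normK ?num_real//.
  by rewrite expr2 !mulrA ler_wpM2r.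
have dwu : 0 < dot w u by apply: lt_le_trans WUle; rewrite mulr_gt0.
have key : enorm w ^+ 2 * enorm u ^+ 2 <= n%:R * dot w u ^+ 2.
  apply: (@le_trans _ _ (n%:R * W ^+ 2 * enorm u ^+ 2)).
    by rewrite ler_wpM2r ?sqr_ge0.
  rewrite -mulrA ler_wpM2l ?(ltW n0)//.
  rewrite [W ^+ 2]expr2 -mulrA.
  apply: (@le_trans _ _ (W * (U * dot w u))); first by rewrite ler_wpM2l// ltW.
  by rewrite mulrA [leRHS]expr2 ler_wpM2r// ltW.
split; first by rewrite divr_ge0 ?mulr_ge0 ?enorm_ge0// ltW.
rewrite /cosv expr_div_n exprMn ler_pdivlMr ?mulr_gt0 ?exprn_gt0//.
by rewrite ler_pdivrMl.
Qed.

End Dot.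

(** * Bounds on A A^T from a right inverse of A *)

Section RightInverse.
Variable R : realType.

Lemma unitmx_gram n d (A : 'M[R]_(n, d)) : row_free A -> A *m A^T \in unitmx.
Proof.
move=> fA; rewrite -row_free_unit; apply: inj_row_free => v vAA.
apply: (row_free_inj fA); rewrite mul0mx -[LHS]trmxK; apply/eqP.
rewrite trmx_eq0; apply/eqP/enorm_eq0/eqP.
rewrite -sqrf_eq0 -dotvv /dot trmxK trmx_mul mulmxA -(mulmxA v).
by rewrite vAA mul0mx mxE.
Qed.

Lemma penrose_row_free n d (A : 'M[R]_(n, d)) :
  row_free A -> penrose A (A^T *m invmx (A *m A^T)).
Proof.
move=> /unitmx_gram uG.
have AX : A *m (A^T *m invmx (A *m A^T)) = 1%:M by rewrite mulmxA mulmxV.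
split; rewrite ?AX ?mul1mx ?trmx1//.
- by rewrite -mulmxA AX mulmx1.
- by rewrite !trmx_mul trmxK trmx_inv trmx_mul trmxK !mulmxA.
Qed.

(** Existence of one Penrose inverse makes [get] return a solution; its first equation reads (A X) A
    = A, and row-freeness cancels the right factor. *)
Lemma mulmx_mpinv n d (A : 'M[R]_(n, d)) : row_free A -> A *m mpinv A = 1%:M.
Proof.
move=> fA; have [AXA _ _ _] : penrose A (mpinv A).
  by apply: (getPex (P := penrose A)); eexists; exact: penrose_row_free.
by apply: (row_free_inj fA); rewrite AXA mul1mx.
Qed.

Lemma opnorm_gt0 m n (A : 'M[R]_(m, n)) (v : 'cV[R]_n) :
  A *m v != 0 -> 0 < opnorm A.
Proof.
rewrite -enorm_gt0 => Av; have := lt_le_trans Av (enorm_mul_le A v).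
have := enorm_ge0 v; nra.
Qed.

Variables (n d : nat) (A : 'M[R]_(n, d)) (X : 'M[R]_(d, n)).
Hypothesis AX : A *m X = 1%:M.

(** Here |u|^2 = u . (A X u) = (A^T u) . (X u), which is at most |A^T u| |X| |u|. *)
Lemma enorm_le_trmx (u : 'cV[R]_n) : enorm u <= opnorm X * enorm (A^T *m u).
Proof.
have [->|u0] := eqVneq u 0; first by rewrite mulmx0 !enorm0 mulr0.
have up : 0 < enorm u by rewrite enorm_gt0.
rewrite -(ler_pM2r up) -expr2 -dotvv -{2}[u]mul1mx -AX -mulmxA -dot_trmx.
apply: le_trans (dot_le _ _) _; rewrite -mulrA mulrCA.
by rewrite ler_wpM2l ?enorm_ge0 ?enorm_mul_le.
Qed.

Lemma opnorm_linv_gt0 (u : 'cV[R]_n) : u != 0 -> 0 < opnorm A /\ 0 < opnorm X.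
Proof.
move=> u0; split; last first.
  apply: (@opnorm_gt0 _ _ X u); apply: contra_neq u0 => Xu.
  by rewrite -[u]mul1mx -AX -mulmxA Xu mulmx0.
by apply: (@opnorm_gt0 _ _ A (X *m u)); rewrite mulmxA AX mul1mx.
Qed.

Lemma dot_gram (u : 'cV[R]_n) : dot u (A *m (A^T *m u)) = enorm (A^T *m u) ^+ 2.
Proof. by rewrite -dotvv dot_trmx. Qed.

Lemma enorm_gram_le (u : 'cV[R]_n) :
  enorm (A *m (A^T *m u)) <= opnorm A * enorm (A^T *m u).
Proof. exact: enorm_mul_le. Qed.

(** Combine |u|^2 <= |X|^2 |A^T u|^2 = |X|^2 (u . A A^T u) with Cauchy-Schwarz. *)
Lemma enorm_gram_ge (u : 'cV[R]_n) :
  enorm u <= opnorm X ^+ 2 * enorm (A *m (A^T *m u)).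
Proof.
have [->|u0] := eqVneq u 0; first by rewrite !mulmx0 !enorm0 mulr0.
have up : 0 < enorm u by rewrite enorm_gt0.
rewrite -(ler_pM2r up) -expr2.
apply: (@le_trans _ _ (opnorm X ^+ 2 * enorm (A^T *m u) ^+ 2)).
  rewrite -exprMn lerXn2r ?nnegrE ?enorm_ge0 ?enorm_le_trmx//.
  by rewrite mulr_ge0 ?enorm_ge0// ltW//; case: (opnorm_linv_gt0 u0).
rewrite -[leRHS]mulrA ler_wpM2l ?sqr_ge0// -dot_gram [leRHS]mulrC.
exact: dot_le.
Qed.

(** The numerator of the cosine is |A^T u|^2, and the two norms in its denominator are at most |X|
    |A^T u| and |A| |A^T u|. *)
Lemma cosv_gram_ge (u : 'cV[R]_n) : u != 0 ->
  (opnorm A * opnorm X)^-1 <= cosv u (A *m (A^T *m u)).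
Proof.
move=> u0; have [A0 X0] := opnorm_linv_gt0 u0.
have up : 0 < enorm u by rewrite enorm_gt0.
have vp : 0 < enorm (A^T *m u).
  by have := lt_le_trans up (enorm_le_trmx u); rewrite pmulr_rgt0.
have gp : 0 < enorm (A *m (A^T *m u)).
  have := lt_le_trans up (enorm_gram_ge u).
  by rewrite pmulr_rgt0// exprn_gt0.
rewrite /cosv dot_gram ler_pdivlMr ?mulr_gt0// ler_pdivrMl ?mulr_gt0//.
apply: le_trans (_ : opnorm X * enorm (A^T *m u) *
                     (opnorm A * enorm (A^T *m u)) <= _).
  apply: ler_pM; rewrite ?enorm_ge0//; first exact: enorm_le_trmx.
  exact: enorm_gram_le.
by rewrite le_eqVlt; apply/orP; left; apply/eqP; ring.
Qed.

End RightInverse.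

(** * One step on the residual *)

Section Step.
Variable R : realType.

(** Bernoulli's inequality, by induction from 1 - s^(k+1) = (1 - s^k) + s^k (1 - s). *)
Lemma onem_exp_le (s : R) k : 0 <= s <= 1 -> 1 - s ^+ k <= k%:R * (1 - s).
Proof.
move=> /andP[s0 s1]; elim: k => [|k IH]; first by rewrite expr0 subrr mul0r.
have sk : s ^+ k <= 1 by rewrite exprn_ile1.
rewrite exprS -natr1; nra.
Qed.

(* With t = s ^+ q.*2 this says that s - c s^(2q+1) is at most its value
   at s = 1. *)
Lemma damped_le (c s : R) q :
    0 <= c -> c * q.*2.+1%:R <= 1 -> 0 <= s <= 1 ->
  s * (1 - c * s ^+ q.*2) <= 1 - c.
Proof.
move=> c0 cq s01; have := onem_exp_le q.*2.+1 s01.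
rewrite exprS; move: s01 => /andP[s0 s1]; nra.
Qed.

(* The normalization by the max norm makes this homogeneous of degree 1 in r. *)
Definition pow_dir n (q : nat) (r : 'cV[R]_n) : 'cV[R]_n :=
  \col_i (r i 0 * (r i 0 / `|r|) ^+ q.*2).

Section PowDir.
Variables (n q : nat) (r : 'cV[R]_n).
Hypothesis r0 : r != 0.

Let rn : 0 < `|r|. Proof. by rewrite normr_gt0. Qed.

Let s i := `|r i 0| / `|r|.

Let s01 i : 0 <= s i <= 1.
Proof. by rewrite divr_ge0//= ler_pdivrMr// mul1r coord_le_norm. Qed.

Let rE i : `|r i 0| = s i * `|r|. Proof. by rewrite divfK// gt_eqF. Qed.

Let ratioE i : (r i 0 / `|r|) ^+ q.*2 = s i ^+ q.*2.
Proof.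
rewrite -muln2 mulnC !exprM; congr (_ ^+ _).
by rewrite -[LHS]real_normK ?num_real// normf_div normr_id.
Qed.

Lemma pow_dir_attained : exists j, `|r j 0| = `|r| /\ pow_dir q r j 0 = r j 0.
Proof.
have [j rj] := norm_attained r0; exists j; split=> //.
by rewrite mxE ratioE /s rj divff ?gt_eqF// expr1n mulr1.
Qed.

Lemma enorm_pow_dir_ge : `|r| <= enorm (pow_dir q r).
Proof. by have [j [<- <-]] := pow_dir_attained; exact: enorm_coord. Qed.

(** At a coordinate [j] of maximal modulus the direction agrees with [r], so the damped coordinate
    is (1 - c) r_j with 1 - c >= 1/2. *)
Lemma enorm_damped_ge (c : R) :
  2 * c <= 1 -> `|r| / 2 <= enorm (r - c *: pow_dir q r).
Proof.
move=> c2; have [j [rj uj]] := pow_dir_attained.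
apply: le_trans (enorm_coord _ j).
rewrite !mxE; rewrite mxE in uj; rewrite uj.
have -> : r j 0 - c * r j 0 = (1 - c) * r j 0 by ring.
have c1 : 0 <= 1 - c by lra.
by rewrite normrM rj (ger0_norm c1) mulrC ler_pM2r//; lra.
Qed.

Lemma cosv_damped (c : R) (w := r - c *: pow_dir q r) :
    0 <= c -> 2 * c <= 1 -> c * q.*2.+1%:R <= 1 ->
  0 <= cosv w (pow_dir q r) /\ n%:R^-1 <= cosv w (pow_dir q r) ^+ 2.
Proof.
move=> c0 c2 cq; have [j [rj uj]] := pow_dir_attained.
have wE i : w i 0 = r i 0 * (1 - c * s i ^+ q.*2).
  by rewrite !mxE ratioE; ring.
have uE i : pow_dir q r i 0 = r i 0 * s i ^+ q.*2 by rewrite mxE ratioE.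
have t01 i : 0 <= s i ^+ q.*2 <= 1.
  by have /andP[? ?] := s01 i; rewrite exprn_ge0//= exprn_ile1.
(* The bounds W and U are the max norms of [w] and of the direction, both attained at [j]. With t =
   s_i^(2q), the cross bound reduces to (1 - c) t <= 1 - c t. *)
apply: (@sqr_cosv_ge _ _ _ _ ((1 - c) * `|r|) `|r| j) => //.
- by rewrite mulr_gt0//; lra.
- rewrite wE uj /s rj divff ?gt_eqF// expr1n mulr1.
  by rewrite -[in RHS]mulrA -expr2 -rj real_normK ?num_real//; ring.
- by rewrite -enorm_gt0 (lt_le_trans _ (enorm_damped_ge c2))// divr_gt0.
- by rewrite -enorm_gt0 (lt_le_trans _ enorm_pow_dir_ge).
move=> i; have /andP[s0 s1] := s01 i; have /andP[t0 t1] := t01 i.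
have ct : 0 <= 1 - c * s i ^+ q.*2 by nra.
split.
- rewrite wE normrM rE (ger0_norm ct) mulrAC ler_pM2r//.
  exact: damped_le.
- rewrite wE uE !normrM rE (ger0_norm ct) (ger0_norm t0).
  have : 0 <= `|r| * (s i * `|r|) by rewrite !mulr_ge0.
  have : (1 - c) * s i ^+ q.*2 <= 1 - c * s i ^+ q.*2 by lra.
  by move=> /[swap] h /(ler_wpM2l h); lra.
- rewrite wE uE mulrACA -expr2 mulr_ge0 ?sqr_ge0//.
  by rewrite mulr_ge0.
Qed.

End PowDir.

Lemma enorm_le_norm n (r : 'cV[R]_n) : enorm r ^+ 2 <= n%:R * `|r| ^+ 2.
Proof. by apply: enorm_le_bound => // i; exact: coord_le_norm. Qed.

Lemma residual_step n d (A : 'M[R]_(n, d)) (X : 'M[R]_(d, n)) q (t : R)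
    (r : 'cV[R]_n) :
    A *m X = 1%:M -> r != 0 -> 0 < t -> t * opnorm A ^+ 2 * q.*2.+1%:R <= 1 ->
    1 <= n%:R^-1 + (opnorm A * opnorm X)^-1 ^+ 2 ->
  enorm (r - t *: (A *m (A^T *m pow_dir q r))) ^+ 2 <=
  enorm r ^+ 2 - t * (n%:R^-1 + (opnorm A * opnorm X)^-1 ^+ 2 - 1)
                 / (2 * opnorm X ^+ 2) * `|r| ^+ 2.
Proof.
move=> AX r0 t0 tA e0; have [A0 X0] := opnorm_linv_gt0 AX r0.
have rn : 0 < `|r| by rewrite normr_gt0.
set u := pow_dir q r; set v := A *m (A^T *m u).
set e := _ - 1; pose c := t * opnorm A ^+ 2 / 2.
have tA0 : 0 <= t * opnorm A ^+ 2 by rewrite mulr_ge0 ?sqr_ge0// ltW.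
have q1 : 1 <= q.*2.+1%:R :> R by rewrite ler1n.
have c0 : 0 <= c by rewrite divr_ge0.
(* The stepsize condition serves twice: [c2] keeps [w] away from 0, and [cq] keeps the largest
   coordinate of [r] the largest in [w]. *)
have c2 : 2 * c <= 1 by rewrite /c; nra.
have cq : c * q.*2.+1%:R <= 1 by rewrite /c; nra.
pose w := r - c *: u.
have [wu0 wu] := cosv_damped r0 c0 c2 cq.
have wge := enorm_damped_ge q r0 c2.
have uge := enorm_pow_dir_ge q r0.
have up : 0 < enorm u by exact: lt_le_trans uge.
have wp : 0 < enorm w by apply: lt_le_trans wge; rewrite divr_gt0.
have vge : `|r| / opnorm X ^+ 2 <= enorm v.
  rewrite ler_pdivrMr ?exprn_gt0// mulrC.
  exact: le_trans (enorm_gram_ge AX u).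
have vp : 0 < enorm v by apply: lt_le_trans vge; rewrite divr_gt0 ?exprn_gt0.
have u0 : u != 0 by rewrite -enorm_gt0.
have uv := cosv_gram_ge AX u0.
have k0 : 0 <= (opnorm A * opnorm X)^-1 by rewrite invr_ge0 mulr_ge0// ltW.
have uv2 : (opnorm A * opnorm X)^-1 ^+ 2 <= cosv u v ^+ 2.
  by rewrite lerXn2r ?nnegrE// (le_trans k0 uv).
have ewv : e / 2 * (enorm w * enorm v) <= dot w v.
  rewrite -ler_pdivlMr ?mulr_gt0// -/(cosv w v).
  apply: (@le_trans _ _ ((cosv w u ^+ 2 + cosv u v ^+ 2 - 1) / 2)).
    by rewrite ler_pM2r ?invr_gt0//; rewrite /e /w /u; lra.
  apply: cosv_trans => //; rewrite -?enorm_gt0//.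
  - exact: le_trans uv.
  - by rewrite (le_trans e0)// lerD.
have v2 : enorm v ^+ 2 <= opnorm A ^+ 2 * dot u v.
  rewrite dot_gram -exprMn lerXn2r ?nnegrE ?mulr_ge0 ?enorm_ge0 ?(ltW A0)//.
  exact: enorm_gram_le.
rewrite enorm_sqrB dotZr enormZ (gtr0_norm t0) exprMn.
have wv : dot w v = dot r v - c * dot u v by rewrite /w dotBl dotZl.
(* Since t |A|^2 = 2 c, [v2] bounds the quadratic term by 2 t c (u . v). *)
have step1 : enorm r ^+ 2 - 2 * (t * dot r v) + t ^+ 2 * enorm v ^+ 2
    <= enorm r ^+ 2 - 2 * t * dot w v.
  rewrite wv /c; have := ler_wpM2l (sqr_ge0 t) v2; nra.
apply: le_trans step1 _; rewrite lerD2l lerN2.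
have ee : 0 <= e by rewrite subr_ge0.
have wvge : `|r| / 2 * (`|r| / opnorm X ^+ 2) <= enorm w * enorm v.
  by apply: ler_pM => //; rewrite divr_ge0 ?sqr_ge0.
(* The decrement is 2 t times the cosine bound [e / 2] and the lower bounds [wge] and [vge] for the
   two norms. *)
apply: (@le_trans _ _ (2 * t * (e / 2 * (`|r| / 2 * (`|r| / opnorm X ^+ 2))))).
  by rewrite le_eqVlt; apply/orP; left; apply/eqP; field; rewrite gt_eqF.
rewrite ler_wpM2l ?mulr_ge0 ?(ltW t0)//.
by apply: le_trans ewv; rewrite ler_wpM2l// divr_ge0.
Qed.

End Step.

(** * From one step to the linear rate of the whole run *)

Section Run.
Variable R : realType.

Lemma cosv_le1 n (u v : 'cV[R]_n) : u != 0 -> v != 0 -> cosv u v <= 1.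
Proof.
rewrite -!enorm_gt0 => u0 v0.
by rewrite /cosv ler_pdivrMr ?mulr_gt0// mul1r dot_le.
Qed.

(** A cosine is at most 1, hence so is its lower bound from [cosv_gram_ge]. *)
Lemma opnorm_mul_ge1 n d (A : 'M[R]_(n, d)) (X : 'M[R]_(d, n)) (u : 'cV[R]_n) :
  A *m X = 1%:M -> u != 0 -> 1 <= opnorm A * opnorm X.
Proof.
move=> AX u0; have [A0 X0] := opnorm_linv_gt0 AX u0.
have v0 : A *m (A^T *m u) != 0.
  rewrite -enorm_gt0; have : 0 < enorm u by rewrite enorm_gt0.
  move=> /lt_le_trans /(_ (enorm_gram_ge AX u)).
  by rewrite pmulr_rgt0// exprn_gt0.
have := le_trans (cosv_gram_ge AX u0) (cosv_le1 u0 v0).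
by rewrite invf_le1// mulr_gt0.
Qed.

(** For n = 1 the term 1 / n is already 1. Otherwise y >= 1 gives y^2 <= y^4 < n / (n - 1), whence 1
    / y^2 > 1 - 1 / n. *)
Lemma cond_gap n (y : R) : (0 < n)%N -> 1 <= y ->
    ((1 < n)%N -> y ^+ 4 < n%:R / (n%:R - 1)) ->
  1 < n%:R^-1 + y^-1 ^+ 2.
Proof.
move=> n0 y1 yn; have y0 : 0 < y by lra.
have z0 : 0 < y^-1 ^+ 2 by rewrite exprn_gt0 ?invr_gt0.
case: n n0 yn => [//|[|n]] _ yn; first by rewrite invr1 ltrDl.
have N1 : 0 < n.+2%:R - 1 :> R by rewrite subr_gt0 ltr1n.
have := yn isT; rewrite ltr_pdivlMr// => {}yn.
have zy : y^-1 ^+ 2 * y ^+ 2 = 1 by rewrite -exprMn mulVf ?expr1n// gt_eqF.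
have y2 : y ^+ 2 <= y ^+ 4 by rewrite ler_weXn2l.
have : y ^+ 2 * (n.+2%:R - 1) < n.+2%:R.
  by apply: le_lt_trans yn; rewrite ler_pM2r.
rewrite -(ltr_pM2l z0 (y ^+ 2 * _)) mulrA zy mul1r => h.
have N0 : 0 < n.+2%:R :> R by rewrite ltr0n.
rewrite -(ltr_pM2r N0) mulrDl mulVf ?gt_eqF//; lra.
Qed.

Lemma q_linear_sqr (u : nat -> R) (delta : R) :
    0 < delta -> (forall k, 0 <= u k) ->
    (forall k, u k.+1 ^+ 2 <= u k ^+ 2 - delta * u k ^+ 2) ->
  q_linear_to0 u.
Proof.
(* The maximum with 1/2 keeps the ratio positive even when [delta >= 1]. *)
move=> d0 u0 du; pose m := Num.max (1 - delta) 2^-1.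
have mE : 1 - delta <= m /\ 2^-1 <= m by rewrite !le_max !lexx orbT.
have m1 : m < 1 by rewrite gt_max; apply/andP; split; lra.
have m0 : 0 < m by lra.
exists (Num.sqrt m); split.
  by rewrite sqrtr_gt0 m0/= -sqrtr1 ltr_sqrt.
move=> k; rewrite -ler_sqr ?nnegrE ?mulr_ge0 ?sqrtr_ge0 ?u0//.
rewrite exprMn sqr_sqrtr ?(ltW m0)//; apply: le_trans (du k) _.
rewrite -[X in X - _]mul1r -mulrBl ler_wpM2r ?sqr_ge0//; lra.
Qed.

(** Pairing the gradient with basis vectors reads off its coordinates. The factor [A^T] in front is
    what makes the residual move by A A^T. *)
Lemma grad_pow_lossE n d (A : 'M[R]_(n, d)) (b : 'cV[R]_n) p (x : 'cV[R]_d) :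
  grad (pow_loss A b p) x =
  (2 * p)%:R *: (A^T *m \col_i ((A *m x - b) i 0 ^+ (2 * p).-1)).
Proof.
apply/colP => j.
have := grad_pow_loss A b p x (delta_mx j 0).
rewrite -colE !mxE => ->; rewrite mulr_sumr; apply: eq_bigr => i _.
by rewrite -colE !mxE; ring.
Qed.

Lemma pow_dirE n q (r : 'cV[R]_n) : r != 0 ->
  \col_i (r i 0 ^+ (2 * q.+1).-1) = `|r| ^+ q.*2 *: pow_dir q r.
Proof.
move=> r0; apply/colP => i; rewrite !mxE.
have rn : `|r| != 0 by rewrite normr_eq0.
rewrite mul2n doubleS /= exprS [RHS]mulrCA; congr (_ * _).
by rewrite expr_div_n mulrC divfK// expf_neq0.
Qed.

(** * Homogeneity of the oracle, with p = q + 1 *)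

Section Constants.
Variables (n d q : nat) (A : 'M[R]_(n, d)).

Definition oracle_coef : R :=
  (2 * q.+1)%:R * ((2 * q.+1)%:R - 1) * opnorm A ^+ 2 * 2 ^ ((2 * q.+1)%:Z - 3).

(** The oracle at radius [kappa] |r|_oo, divided by |r|_oo^(2q). *)
Definition oracle_const (kappa : R) : R :=
  oracle_coef *
  (1 + (\big[Num.max/0]_(i < n) enorm (row i A)^T ^+ q.*2) * kappa ^+ q.*2).

Lemma pow_oracle_scale (b : 'cV[R]_n) (x : 'cV[R]_d) kappa :
  pow_oracle A b q.+1 x (kappa * `|A *m x - b|) =
  oracle_const kappa * `|A *m x - b| ^+ q.*2.
Proof.
rewrite /pow_oracle /oracle_const -/oracle_coef.
by rewrite mul2n doubleS -addn2 addnK exprMn; ring.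
Qed.

(** The remaining factor, 2^(2q-1) times the bracket, is at least 1. This is what makes the stepsize
    small enough for [residual_step]. *)
Lemma oracle_const_ge kappa : (0 < n)%N -> 1 <= kappa ->
  (2 * q.+1)%:R * q.*2.+1%:R * opnorm A ^+ 2 <= oracle_const kappa.
Proof.
move=> n0 k1; rewrite /oracle_const /oracle_coef.
have -> : (2 * q.+1)%:R - 1 = q.*2.+1%:R :> R.
  by rewrite mul2n doubleS -[q.*2.+2%:R]natr1 addrK.
rewrite -[leRHS]mulrA ler_peMr//.
  by rewrite mulr_ge0 ?sqr_ge0// mulr_ge0.
set mx := \big[_/_]_(i < n) _.
have mx0 : 0 <= mx by exact: bigmax_ge_id.
case: q @mx mx0 => [|q'] mx mx0.
  (* For q = 0 the power of two is 1/2, but a maximum of zeroth powers over a nonempty index set is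
     at least 1, so the bracket is at least 2. *)
  rewrite expr0 mulr1.
  have : 1 <= mx.
    exact: (le_bigmax _ (fun i => enorm (row i A)^T ^+ 0) (Ordinal n0)).
  have -> : (2 * 1)%:Z - 3 = -1 by [].
  by rewrite exprN1; lra.
have -> : (2 * q'.+2)%:Z - 3 = q'.*2.+1%:Z.
  by rewrite mul2n !doubleS subzn.
rewrite mulr_ege1//; first by rewrite -exprnP exprn_ege1// ler1n.
by rewrite lerDl mulr_ge0// exprn_ge0// (le_trans _ k1).
Qed.

End Constants.

(** The gradient bound has degree 2q + 1 and the oracle degree 2q in |r|_oo, so the radius is a
    fixed multiple of |r|_oo, and the factor |r|_oo^(2q) cancels between gradient and oracle. *)
Lemma gd_residual n d q (A : 'M[R]_(n, d)) (b : 'cV[R]_n) (eta : R) x :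
    (0 < n)%N -> 0 < opnorm A -> 0 < eta <= 1 ->
    (forall k, A *m x k != b) ->
    gd_lfso (pow_lfso A b q.+1) eta (fun k => `|A *m x k - b|)
      (fun k => pow_grad_bound A b q.+1 (x k)) x ->
  exists t : R, [/\ 0 < t, t * opnorm A ^+ 2 * q.*2.+1%:R <= 1 &
    forall k, A *m x k.+1 - b = A *m x k - b
      - t *: (A *m (A^T *m pow_dir q (A *m x k - b)))].
Proof.
move=> n0 A0 /andP[eta0 eta1] xb gd.
pose K := @oracle_const n d q A.
(* The ratio of the enlarged radius to |r|_oo, the same for all iterates. *)
pose kappa :=
  Num.max 1 (eta / K 1 * ((2 * q.+1)%:R * opnorm A * Num.sqrt n%:R)).
have k1 : 1 <= kappa by rewrite le_max lexx.
have p0 : 0 < (2 * q.+1)%:R :> R by rewrite ltr0n.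
have q0 : 0 < q.*2.+1%:R :> R by rewrite ltr0n.
have C0 : 0 < (2 * q.+1)%:R * q.*2.+1%:R * opnorm A ^+ 2.
  by rewrite mulr_gt0 ?exprn_gt0// mulr_gt0.
have K0 c : 1 <= c -> 0 < K c.
  by move=> c1; apply: lt_le_trans (oracle_const_ge _ _ n0 c1).
have Kk := K0 _ k1.
(* The factor 2p = 2(q + 1) comes from the gradient. *)
exists (eta * (2 * q.+1)%:R / K kappa); split.
- by rewrite divr_gt0// mulr_gt0.
- rewrite !(mulrAC _ (K kappa)^-1) ler_pdivrMr// mul1r.
  apply: le_trans (oracle_const_ge _ _ n0 k1).
  have -> (e a c g : R) : e * a * c * g = e * (a * g * c) by ring.
  by rewrite ler_piMl// ltW.
move=> k; have [_ /= ->] := gd k.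
set r := A *m x k - b.
have r0 : r != 0 by rewrite subr_eq0.
have rn : 0 < `|r| by rewrite normr_gt0.
have LK c : pow_oracle A b q.+1 (x k) (c * `|r|) = K c * `|r| ^+ q.*2.
  exact: pow_oracle_scale.
have radE : Num.max `|r| (eta / pow_oracle A b q.+1 (x k) `|r| *
    pow_grad_bound A b q.+1 (x k)) = kappa * `|r|.
  rewrite /kappa maxr_pMl ?ltW// mul1r; congr Num.max.
  rewrite -{1}[`|r|]mul1r LK /pow_grad_bound -/r.
  have -> : (2 * q.+1 - 1)%N = q.*2.+1 by rewrite mul2n doubleS subn1.
  by rewrite exprS; field; rewrite !gt_eqF ?exprn_gt0 ?K0.
rewrite radE LK grad_pow_lossE pow_dirE//.
rewrite mulmxBr -!scalemxAr !scalerA addrAC; congr (_ - _ *: _).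
by rewrite -/r; field; rewrite !gt_eqF ?exprn_gt0.
Qed.

End Run.

Theorem theorem5p3 (R : realType) (n d p : nat)
    (A : 'M[R]_(n, d)) (b : 'cV[R]_n) (eta : R) (x : nat -> 'cV[R]_d)
    (n_ge1 : (1 <= n)%N) (p_ge1 : (1 <= p)%N)
    (A_full_rank : \rank A = minn n d) (le_nd : (n <= d)%N)
    (* n / (n - 1) is infinite when n = 1 *)
    (cond_A : (1 < n)%N -> cond2 A ^+ 4 < n%:R / (n%:R - 1))
    (eta_itv : 0 < eta <= 1)
    (residual_neq0 : forall k, A *m x k != b)
    (x_gd : gd_lfso (pow_lfso A b p) eta
              (fun k => `|A *m x k - b|)
              (fun k => pow_grad_bound A b p (x k)) x) :
  q_linear_to0 (fun k => enorm (A *m x k - b)).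
Proof.
have fA : row_free A by rewrite /row_free A_full_rank (minn_idPl le_nd).
have AX := mulmx_mpinv fA.
have r0 k : A *m x k - b != 0 by rewrite subr_eq0.
have [A0 X0] := opnorm_linv_gt0 AX (r0 0%N).
have gap := cond_gap n_ge1 (opnorm_mul_ge1 AX (r0 0%N)) cond_A.
case: p p_ge1 x_gd => // q _ x_gd.
have [t [t0 tA step]] := gd_residual n_ge1 A0 eta_itv residual_neq0 x_gd.
set e := n%:R^-1 + _ in gap.
pose D := t * (e - 1) / (2 * opnorm (mpinv A) ^+ 2).
have D0 : 0 < D by rewrite divr_gt0 ?mulr_gt0 ?exprn_gt0// subr_gt0.
have n0 : 0 < n%:R :> R by rewrite ltr0n.
(* [D] measures the decrease in units of |r|_oo^2; passing to the Euclidean norm through |r|^2 <= n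
   |r|_oo^2 costs the factor n. *)
apply: (@q_linear_sqr _ _ (D / n%:R)); first by rewrite divr_gt0.
  by move=> k; exact: enorm_ge0.
move=> k; rewrite step.
apply: le_trans (residual_step AX (r0 k) t0 tA (ltW gap)) _.
rewrite lerD2l lerN2 -/e -/D -[leLHS]mulrA ler_wpM2l ?(ltW D0)//.
by rewrite ler_pdivrMl// enorm_le_norm.
Qed.
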